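(* Let $(\mathscr{E},\mathcal{S})$ be an exact category and $\mathscr{N}$ a full subcategory of $\mathscr{E}$ closed under finite direct sums. Let $\mathscr{E}/\mathscr{N}$ be the quotient category. For a subcategory $\mathscr{D}$ of $\mathscr{E}$ containing $\mathscr{N}$, let $F\mathscr{D}$ be the full subcategory of $\mathscr{E}/\mathscr{N}$ whose objects are the objects of $\mathscr{D}$; for a subcategory $\mathscr{D}_{\mathscr{N}}$ of $\mathscr{E}/\mathscr{N}$, let $G\mathscr{D}_{\mathscr{N}}$ be the full subcategory of $\mathscr{E}$ whose objects are the objects of $\mathscr{D}_{\mathscr{N}}$. (1) $F$ and $G$ give a one-to-one correspondence (mutually inverse bijections) between thick subcategories of $\mathscr{E}$ containing $\mathscr{N}$ and thick subcategories of $\mathscr{E}/\mathscr{N}$. (2) Assume in addition that $\mathscr{N}$ is factorization admissible and that $\mathscr{E}/\mathscr{N}$ satisfies the Weak Five Lemma for $\mathcal{S}_{\mathscr{N}}$. Then $F$ and $G$ give a one-to-one correspondence (mutually inverse bijections) between complete subcategories of $\mathscr{E}$ containing $\mathscr{N}$ and complete subcategories of $\mathscr{E}/\mathscr{N}$.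
   Context: Exact category: $(\mathscr{E},\mathcal{S})$ is an exact category in the sense of Quillen: $\mathscr{E}$ is additive and $\mathcal{S}$ is a family, closed under isomorphisms, of kernel-cokernel pairs $X\xrightarrow{f}Y\xrightarrow{g}Z$ ($f$ is a kernel of $g$, $g$ is a cokernel of $f$), called short exact sequences; $f$ is then called an admissible monomorphism and $g$ an admissible epimorphism. The axioms are: $1_0$ is an admissible epimorphism; admissible epimorphisms are closed under composition; pullbacks of admissible epimorphisms along arbitrary morphisms exist and are admissible epimorphisms; pushouts of admissible monomorphisms along arbitrary morphisms exist and are admissible monomorphisms. Quotient category: $\mathscr{N}$ is closed under finite direct sums (the empty sum included). $\mathscr{E}/\mathscr{N}$ has the same objects as $\mathscr{E}$, and its morphisms $X\to Y$ are the elements of $\mathrm{Hom}_{\mathscr{E}}(X,Y)$ modulo the subgroup of morphisms that factor through some object of $\mathscr{N}$; $\underline{f}$ denotes the class of $f$. $\mathcal{S}_{\mathscr{N}}$ is the collection of all sequences $X\xrightarrow{\underline f}Y\xrightarrow{\underline g}Z$ in $\mathscr{E}/\mathscr{N}$ that are isomorphic (via a commutative diagram of isomorphisms in $\mathscr{E}/\mathscr{N}$) to a sequence $X'\xrightarrow{\underline{f}'}Y'\xrightarrow{\underline{g}'}Z'$ with $X'\xrightarrow{f'}Y'\xrightarrow{g'}Z'$ in $\mathcal{S}$. A nonempty subcategory $\mathscr{D}$ of $\mathscr{E}$ (respectively, of $\mathscr{E}/\mathscr{N}$) is complete if (i) it is full, and (ii) whenever $X\to Y\to Z$ is in $\mathcal{S}$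 (respectively, in $\mathcal{S}_{\mathscr{N}}$) and two of $X,Y,Z$ are in $\mathscr{D}$, then so is the third. It is thick if in addition (iii) it is closed under direct summands: if $A$ is a direct summand of $X$ and $X\in\mathscr{D}$, then $A\in\mathscr{D}$. Here $A$ is a direct summand of $X$ if there are morphisms $A\xrightarrow{i}X\xrightarrow{p}A$ with $pi=1_A$. $\mathscr{N}$ is factorization admissible if it is closed under finite direct sums and direct summands, and whenever a morphism $f:X\to Y$ of $\mathscr{E}$ factors through an object of $\mathscr{N}$, there is a factorization $f=\beta\alpha$ with $\alpha:X\to N$, $\beta:N\to Y$, $N\in\mathscr{N}$, such that either $\alpha$ is an admissible monomorphism or $\beta$ is an admissible epimorphism. $\mathscr{E}/\mathscr{N}$ satisfies the Weak Five Lemma for $\mathcal{S}_{\mathscr{N}}$ if for every morphism $(\underline f,\underline g,\underline h)$ (commutative diagram) from a sequence $X\to Y\to Z$ in $\mathcal{S}_{\mathscr{N}}$ to a sequence $X'\to Y'\to Z'$ in $\mathcal{S}_{\mathscr{N}}$, with $\underline f:X\to X'$, $\underline g:Y\to Y'$, $\underline h:Z\to Z'$: (i) if $\underline f$ and $\underline g$ are isomorphisms and $Z'=0$, then $\underline h$ is an isomorphism (i.e. $Z\cong 0$); (ii) if $\underline g$ and $\underline h$ are isomorphisms and $X=0$, then $\underline f$ is an isomorphism. A subcategory contains $\mathscr{N}$ if all objects of $\mathscr{N}$ are objects of it. *)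

(* Defs.v *)
From HB Require Import structures.
From mathcomp Require Import all_boot all_order all_algebra.
From mathcomp Require Import boolp.

Set Implicit Arguments.
Unset Strict Implicit.
Unset Printing Implicit Defensive.

Import GRing.Theory.
Local Open Scope ring_scope.
Local Open Scope quotient_scope.

Record preadditive : Type := Preadditive {
  obj :> Type;
  hom : obj -> obj -> zmodType;
  idm : forall X : obj, hom X X;
  comp : forall X Y Z : obj, hom Y Z -> hom X Y -> hom X Z;
  compA : forall (X Y Z W : obj) (h : hom Z W) (g : hom Y Z) (f : hom X Y),
    comp h (comp g f) = comp (comp h g) f;
  comp1m : forall (X Y : obj) (f : hom X Y), comp (idm Y) f = f;
  compm1 : forall (X Y : obj) (f : hom X Y), comp f (idm X) = f;
  compDl : forall (X Y Z : obj) (g g' : hom Y Z) (f : hom X Y),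
    comp (g + g') f = comp g f + comp g' f;
  compDr : forall (X Y Z : obj) (g : hom Y Z) (f f' : hom X Y),
    comp g (f + f') = comp g f + comp g f' }.

Arguments hom {p} X Y.
Arguments idm {p} X.
Arguments comp {p X Y Z} g f.

Notation "g \oc f" := (comp g f) (at level 40, left associativity).

Section Basic.
Variable C : preadditive.
Implicit Types X Y Z A : C.

Definition is_iso X Y (f : hom X Y) : Prop :=
  exists g : hom Y X, g \oc f = idm X /\ f \oc g = idm Y.

(* Each hom group contains 0, so "exactly one morphism" means "only 0". *)
Definition is_zero X : Prop :=
  forall Y, (forall f : hom X Y, f = 0) /\ (forall f : hom Y X, f = 0).

Definition is_summand A X : Prop :=
  exists (i : hom A X) (p : hom X A), p \oc i = idm A.

(* [n] may be 0: then the last equation says that [S] is a zero object. *)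
Definition is_dsum (n : nat) (X : 'I_n -> C) (S : C) : Prop :=
  exists (i : forall k, hom (X k) S) (p : forall k, hom S (X k)),
    [/\ forall k, p k \oc i k = idm (X k),
        forall k l, k != l -> p l \oc i k = 0
      & \sum_(k < n) (i k \oc p k) = idm S].

Definition is_additive : Prop :=
  forall (n : nat) (X : 'I_n -> C), exists S : C, is_dsum X S.

Definition is_kernel X Y Z (f : hom X Y) (g : hom Y Z) : Prop :=
  g \oc f = 0 /\
  forall W (h : hom W Y), g \oc h = 0 -> exists! u : hom W X, f \oc u = h.

Definition is_cokernel X Y Z (g : hom Y Z) (f : hom X Y) : Prop :=
  g \oc f = 0 /\
  forall W (h : hom Y W), h \oc f = 0 -> exists! u : hom Z W, u \oc g = h.

Definition is_pullback X Y Z P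
    (g : hom Y Z) (h : hom X Z) (g' : hom P X) (h' : hom P Y) : Prop :=
  g \oc h' = h \oc g' /\
  forall W (a : hom W X) (b : hom W Y), g \oc b = h \oc a ->
    exists! u : hom W P, g' \oc u = a /\ h' \oc u = b.

Definition is_pushout X Y Z P
    (f : hom X Y) (h : hom X Z) (f' : hom Z P) (h' : hom Y P) : Prop :=
  h' \oc f = f' \oc h /\
  forall W (a : hom Z W) (b : hom Y W), b \oc f = a \oc h ->
    exists! u : hom P W, u \oc f' = a /\ u \oc h' = b.

Definition seq_class : Type :=
  forall X Y Z : C, hom X Y -> hom Y Z -> Prop.

Definition seq_mor X Y Z X' Y' Z' (f : hom X Y) (g : hom Y Z)
    (f' : hom X' Y') (g' : hom Y' Z')
    (a : hom X X') (b : hom Y Y') (c : hom Z Z') : Prop :=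
  f' \oc a = b \oc f /\ g' \oc b = c \oc g.

Definition seq_iso X Y Z X' Y' Z' (f : hom X Y) (g : hom Y Z)
    (f' : hom X' Y') (g' : hom Y' Z') : Prop :=
  exists (a : hom X X') (b : hom Y Y') (c : hom Z Z'),
    [/\ seq_mor f g f' g' a b c, is_iso a, is_iso b & is_iso c].

Section Admissible.
Variable S : seq_class.

Definition adm_mono X Y (f : hom X Y) : Prop :=
  exists (Z : C) (g : hom Y Z), S f g.

Definition adm_epi Y Z (g : hom Y Z) : Prop :=
  exists (X : C) (f : hom X Y), S f g.

Record is_exact : Prop := IsExact {
  exact_additive : is_additive;
  exact_kercoker : forall X Y Z (f : hom X Y) (g : hom Y Z),
    S f g -> is_kernel f g /\ is_cokernel g f;
  exact_iso_closed : forall X Y Z X' Y' Z' (f : hom X Y) (g : hom Y Z)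
      (f' : hom X' Y') (g' : hom Y' Z'),
    seq_iso f g f' g' -> S f g -> S f' g';
  exact_id0 : forall X, is_zero X -> adm_epi (idm X);
  exact_comp : forall X Y Z (g : hom X Y) (h : hom Y Z),
    adm_epi g -> adm_epi h -> adm_epi (h \oc g);
  exact_pullback : forall X Y Z (g : hom Y Z) (h : hom X Z), adm_epi g ->
    (exists (P : C) (g' : hom P X) (h' : hom P Y), is_pullback g h g' h') /\
    (forall P (g' : hom P X) (h' : hom P Y),
       is_pullback g h g' h' -> adm_epi g');
  exact_pushout : forall X Y Z (f : hom X Y) (h : hom X Z), adm_mono f ->
    (exists (P : C) (f' : hom Z P) (h' : hom Y P), is_pushout f h f' h') /\
    (forall P (f' : hom Z P) (h' : hom Y P),
       is_pushout f h f' h' -> adm_mono f') }.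

Definition weak_five_lemma : Prop :=
  forall X Y Z X' Y' Z' (u : hom X Y) (v : hom Y Z)
    (u' : hom X' Y') (v' : hom Y' Z')
    (f : hom X X') (g : hom Y Y') (h : hom Z Z'),
    S u v -> S u' v' -> seq_mor u v u' v' f g h ->
    (is_iso f -> is_iso g -> is_zero Z' -> is_iso h) /\
    (is_iso g -> is_iso h -> is_zero X -> is_iso f).

End Admissible.

Record subcat : Type := Subcat {
  sub_obj :> C -> Prop;
  sub_hom : forall X Y, hom X Y -> Prop;
  sub_dom : forall X Y (f : hom X Y), sub_hom f -> sub_obj X;
  sub_cod : forall X Y (f : hom X Y), sub_hom f -> sub_obj Y;
  sub_idm : forall X, sub_obj X -> sub_hom (idm X);
  sub_comp : forall X Y Z (g : hom Y Z) (f : hom X Y),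
    sub_hom g -> sub_hom f -> sub_hom (g \oc f) }.

Definition is_full (D : subcat) : Prop :=
  forall X Y (f : hom X Y), D X -> D Y -> sub_hom D f.

Definition full_subcat (P : C -> Prop) : subcat.
Proof.
apply: (@Subcat P (fun X Y _ => P X /\ P Y)).
- by move=> X Y _ [].
- by move=> X Y _ [].
- by move=> X PX.
- by move=> X Y Z _ _ [_ PZ] [PX _].
Defined.

(* The subcategory need not be closed under isomorphisms, so only some direct
   sum of each finite family is required to lie in it. *)
Definition dsum_closed (D : subcat) : Prop :=
  forall (n : nat) (X : 'I_n -> C), (forall k, D (X k)) ->
    exists2 S : C, is_dsum X S & D S.

Definition summand_closed (D : subcat) : Prop :=
  forall A X, is_summand A X -> D X -> D A.

Definition is_complete (S : seq_class) (D : subcat) : Prop :=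
  [/\ exists X, D X,
      is_full D
    & forall X Y Z (f : hom X Y) (g : hom Y Z), S X Y Z f g ->
        [/\ D X -> D Y -> D Z, D X -> D Z -> D Y & D Y -> D Z -> D X]].

Definition is_thick (S : seq_class) (D : subcat) : Prop :=
  is_complete S D /\ summand_closed D.

Definition factors_through (N : subcat) X Y (f : hom X Y) : Prop :=
  exists (M : C) (a : hom X M) (b : hom M Y), N M /\ f = b \oc a.

Definition factorization_admissible (S : seq_class) (N : subcat) : Prop :=
  [/\ dsum_closed N,
      summand_closed N
    & forall X Y (f : hom X Y), factors_through N f ->
        exists (M : C) (a : hom X M) (b : hom M Y),
          [/\ N M, f = b \oc a & adm_mono S a \/ adm_epi S b]].

Definition contains (D N : subcat) : Prop := forall X, N X -> D X.

Lemma comp0m X Y Z (f : hom X Y) : (0 : hom Y Z) \oc f = 0.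
Proof. by apply: (addrI (0 \oc f)); rewrite -compDl !addr0. Qed.

Lemma compm0 X Y Z (g : hom Y Z) : g \oc (0 : hom X Y) = 0.
Proof. by apply: (addrI (g \oc 0)); rewrite -compDr !addr0. Qed.

Lemma compNm X Y Z (g : hom Y Z) (f : hom X Y) : (- g) \oc f = - (g \oc f).
Proof. by apply: (addrI (g \oc f)); rewrite -compDl !subrr comp0m. Qed.

Lemma compmN X Y Z (g : hom Y Z) (f : hom X Y) : g \oc (- f) = - (g \oc f).
Proof. by apply: (addrI (g \oc f)); rewrite -compDr !subrr compm0. Qed.

Lemma compBl X Y Z (g g' : hom Y Z) (f : hom X Y) :
  (g - g') \oc f = g \oc f - g' \oc f.
Proof. by rewrite compDl compNm. Qed.

Lemma compBr X Y Z (g : hom Y Z) (f f' : hom X Y) :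
  g \oc (f - f') = g \oc f - g \oc f'.
Proof. by rewrite compDr compmN. Qed.

End Basic.

Section Quotient.
Variables (E : preadditive) (N : subcat E) (hN : dsum_closed N).

(* [hN] is a phantom argument: it lets the subgroup structure be inferred. *)
Definition ideal_of (_ : dsum_closed N) (X Y : E) : {pred hom X Y} :=
  fun f => `[< factors_through N f >].

Arguments ideal_of _ X Y : clear implicits.

Lemma ideal_ofP (X Y : E) (f : hom X Y) :
  reflect (factors_through N f) (f \in ideal_of hN X Y).
Proof. exact: asboolP. Qed.

Lemma ideal_of_zmod_closed (X Y : E) : zmod_closed (ideal_of hN X Y).
Proof.
split=> [|f f' /ideal_ofP[M [a [b [NM ->]]]] /ideal_ofP[M' [a' [b' [NM' ->]]]]].
  have [Z _ NZ] : exists2 Z : E, is_dsum (fun _ : 'I_0 => X) Z & N Z.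
    by apply: hN => -[].
  by apply/ideal_ofP; exists Z, 0, 0; rewrite comp0m.
pose T (k : 'I_2) := if k == 0 then M else M'.
have [D [i [p [pi1 pi0 _]]] ND] : exists2 D : E, is_dsum T D & N D.
  by apply: hN => k; rewrite /T; case: ifP.
move: (i 0) (i 1) (p 0) (p 1) (pi1 0) (pi1 1) (pi0 0 1 isT) (pi0 1 0 isT).
rewrite /T /= => i0 i1 p0 p1 e00 e11 e01 e10.
apply/ideal_ofP.
exists D, (i0 \oc a - i1 \oc a'), (b \oc p0 + b' \oc p1); split=> //.
rewrite compBr !compDl !compA.
rewrite -!(compA _ p0) -!(compA _ p1) e00 e11 e01 e10.
by rewrite !compm1 !compm0 !comp0m addr0 add0r.
Qed.

HB.instance Definition _ (X Y : E) :=
  GRing.isZmodClosed.Build (hom X Y) (ideal_of hN X Y)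
    (ideal_of_zmod_closed X Y).

Definition qhom (X Y : E) : zmodType := Quotient.quot (ideal_of hN X Y).

Definition qclass (X Y : E) (f : hom X Y) : qhom X Y := \pi f.

Lemma qclassP (X Y : E) (f g : hom X Y) :
  qclass f = qclass g <-> factors_through N (f - g).
Proof.
split=> [h | h].
  by apply/(ideal_ofP); rewrite Quotient.idealrBE; apply/eqP.
by apply/eqP; rewrite -Quotient.idealrBE; apply/ideal_ofP.
Qed.

Lemma qclass_repr (X Y : E) (u : qhom X Y) : qclass (repr u) = u.
Proof. exact: reprK. Qed.

Lemma qclassD (X Y : E) (f g : hom X Y) :
  qclass (f + g) = qclass f + qclass g.
Proof. exact: raddfD. Qed.

Definition qidm (X : E) : qhom X X := qclass (idm X).

Definition qcomp (X Y Z : E) (v : qhom Y Z) (u : qhom X Y) : qhom X Z :=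
  qclass (repr v \oc repr u).

Lemma qcompE (X Y Z : E) (g : hom Y Z) (f : hom X Y) :
  qcomp (qclass g) (qclass f) = qclass (g \oc f).
Proof.
have /qclassP[M [a [b [NM eg]]]] := qclass_repr (qclass g).
have /qclassP[M' [a' [b' [NM' ef]]]] := qclass_repr (qclass f).
set g' := repr (qclass g) in eg *; set f' := repr (qclass f) in ef *.
rewrite /qcomp -/g' -/f'; transitivity (qclass (g \oc f')).
  by apply/qclassP; exists M, (a \oc f'), b; split; rewrite // -compBl eg compA.
by apply/qclassP; exists M', a', (g \oc b'); split; rewrite // -compBr ef compA.
Qed.

Definition quotient_cat : preadditive.
Proof.
apply: (@Preadditive E qhom qidm qcomp).
- move=> X Y Z W h g f.
  rewrite -(qclass_repr h) -(qclass_repr g) -(qclass_repr f).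
  by rewrite !qcompE compA.
- by move=> X Y f; rewrite -(qclass_repr f) qcompE comp1m.
- by move=> X Y f; rewrite -(qclass_repr f) qcompE compm1.
- move=> X Y Z g g' f.
  rewrite -(qclass_repr g) -(qclass_repr g') -(qclass_repr f).
  by rewrite -qclassD !qcompE compDl qclassD.
- move=> X Y Z g f f'.
  rewrite -(qclass_repr g) -(qclass_repr f) -(qclass_repr f').
  by rewrite -qclassD !qcompE compDr qclassD.
Defined.

Definition qmor (X Y : E) (f : hom X Y) : @hom quotient_cat X Y := qclass f.

Definition quotient_seqs (S : seq_class E) : seq_class quotient_cat :=
  fun X Y Z u v =>
    exists (X' Y' Z' : E) (f : hom X' Y') (g : hom Y' Z'),
      S X' Y' Z' f g /\ seq_iso u v (qmor f) (qmor g).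

Definition F_sub (D : subcat E) : subcat quotient_cat :=
  @full_subcat quotient_cat (fun X : E => D X).

Definition G_sub (D : subcat quotient_cat) : subcat E :=
  full_subcat (fun X : E => D X).

End Quotient.

Arguments quotient_cat {E N} hN.
Arguments qmor {E N} hN {X Y} f.
Arguments quotient_seqs {E N} hN S.
Arguments F_sub {E N} hN D.
Arguments G_sub {E N} hN D.

Definition mutually_inverse (T U : Type) (P : T -> Prop) (Q : U -> Prop)
    (F : T -> U) (G : U -> T) : Prop :=
  [/\ forall x, P x -> Q (F x),
      forall y, Q y -> P (G y),
      forall x, P x -> G (F x) = x
    & forall y, Q y -> F (G y) = y].

(* Main.v *)
(* The point is that a subcategory of E containing N, thick in (1) and complete
   in (2), is closed under isomorphism in E/N.  If f : X -> X' and g : X' -> X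
   are inverse modulo N, then g f = 1 + b a with a : X -> M, b : M -> X and M in
   N, so X is a summand of X' (+) M; this settles the thick case.  If moreover a
   is an admissible monomorphism, then so is (f, a) : X -> X' (+) M; in E/N it
   is an isomorphism, so by the Weak Five Lemma its cokernel C vanishes in E/N,
   that is, C lies in N.  Hence if X lies in a complete subcategory containing
   N, so do X' (+) M and X'.  The case of an admissible epimorphism b is dual.
   In the other direction, an object of N is zero in E/N, hence is the third
   term of a sequence X -> X -> 0. *)

From mathcomp Require Import all_boot all_order all_algebra.
From mathcomp Require Import boolp.
Require Import Defs.

Set Implicit Arguments.
Unset Strict Implicit.
Unset Printing Implicit Defensive.

Import GRing.Theory.
Local Open Scope ring_scope.

(** * Isomorphisms, kernels, cokernels and biproducts in a preadditive category *)

Section Preadditive.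
Variable C : preadditive.
Implicit Types X Y Z W A K P : C.

Lemma idm_iso X : is_iso (idm X).
Proof. by exists (idm X); rewrite comp1m. Qed.

Lemma zero_iso X Y (f : hom X Y) : is_zero X -> is_zero Y -> is_iso f.
Proof.
move=> X0 Y0; exists 0.
by rewrite [_ \oc f](X0 _).1 [f \oc _](Y0 _).1 [idm X](X0 _).1 [idm Y](Y0 _).1.
Qed.

Lemma iso_comp X Y Z (g : hom Y Z) (f : hom X Y) :
  is_iso g -> is_iso f -> is_iso (g \oc f).
Proof.
move=> [g' [g'g gg']] [f' [f'f ff']]; exists (f' \oc g').
split; first by rewrite compA -(compA f') g'g compm1.
by rewrite compA -(compA g) ff' compm1.
Qed.

Lemma kernel_inj X Y Z (f : hom X Y) (g : hom Y Z) W (u v : hom W X) :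
  is_kernel f g -> f \oc u = f \oc v -> u = v.
Proof.
move=> [gf0 ker] e; have [|w [_ w_uniq]] := ker W (f \oc v).
  by rewrite compA gf0 comp0m.
by rewrite -(w_uniq u e) -(w_uniq v erefl).
Qed.

Lemma cokernel_inj X Y Z (f : hom X Y) (g : hom Y Z) W (u v : hom Z W) :
  is_cokernel g f -> u \oc g = v \oc g -> u = v.
Proof.
move=> [gf0 coker] e; have [|w [_ w_uniq]] := coker W (v \oc g).
  by rewrite -compA gf0 compm0.
by rewrite -(w_uniq u e) -(w_uniq v erefl).
Qed.

Lemma kernel_lift X Y Z (f : hom X Y) (g : hom Y Z) W (h : hom W Y) :
  is_kernel f g -> g \oc h = 0 -> exists u, f \oc u = h.
Proof. by move=> [_ ker] /ker[u [eu _]]; exists u. Qed.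

Lemma cokernel_desc X Y Z (f : hom X Y) (g : hom Y Z) W (h : hom Y W) :
  is_cokernel g f -> h \oc f = 0 -> exists u, u \oc g = h.
Proof. by move=> [_ coker] /coker[u [eu _]]; exists u. Qed.

Lemma kernelI X Y Z (f : hom X Y) (g : hom Y Z) :
  g \oc f = 0 ->
  (forall W (u v : hom W X), f \oc u = f \oc v -> u = v) ->
  (forall W (h : hom W Y), g \oc h = 0 -> exists u, f \oc u = h) ->
  is_kernel f g.
Proof.
move=> gf0 inj lift; split=> // W h /lift[u eu]; exists u; split=> // v ev.
by apply: inj; rewrite eu ev.
Qed.

Lemma cokernelI X Y Z (f : hom X Y) (g : hom Y Z) :
  g \oc f = 0 ->
  (forall W (u v : hom Z W), u \oc g = v \oc g -> u = v) ->
  (forall W (h : hom Y W), h \oc f = 0 -> exists u, u \oc g = h) ->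
  is_cokernel g f.
Proof.
move=> gf0 inj desc; split=> // W h /desc[u eu]; exists u; split=> // v ev.
by apply: inj; rewrite eu ev.
Qed.

Lemma pushout_inj X Y Z P (f : hom X Y) (h : hom X Z) (f' : hom Z P)
    (h' : hom Y P) W (u v : hom P W) :
  is_pushout f h f' h' ->
  u \oc f' = v \oc f' -> u \oc h' = v \oc h' -> u = v.
Proof.
move=> [e po] e1 e2; have [|w [_ w_uniq]] := po W (v \oc f') (v \oc h').
  by rewrite -!compA e.
by rewrite -(w_uniq u (conj e1 e2)) -(w_uniq v (conj erefl erefl)).
Qed.

Lemma pullback_inj X Y Z P (g : hom Y Z) (h : hom X Z) (g' : hom P X)
    (h' : hom P Y) W (u v : hom W P) :
  is_pullback g h g' h' ->
  g' \oc u = g' \oc v -> h' \oc u = h' \oc v -> u = v.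
Proof.
move=> [e pb] e1 e2; have [|w [_ w_uniq]] := pb W (g' \oc v) (h' \oc v).
  by rewrite !compA e.
by rewrite -(w_uniq u (conj e1 e2)) -(w_uniq v (conj erefl erefl)).
Qed.

(** The two-term case of [is_dsum], with the four maps named separately so that no family of objects
    over ['I_2], with its dependent types, appears in later computations. *)
Record is_biprod X Y P (i1 : hom X P) (p1 : hom P X) (i2 : hom Y P)
    (p2 : hom P Y) : Prop := IsBiprod {
  biprod11 : p1 \oc i1 = idm X;
  biprod22 : p2 \oc i2 = idm Y;
  biprod12 : p2 \oc i1 = 0;
  biprod21 : p1 \oc i2 = 0;
  biprod_sum : i1 \oc p1 + i2 \oc p2 = idm P }.

Lemma biprodC X Y P (i1 : hom X P) p1 (i2 : hom Y P) p2 :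
  is_biprod i1 p1 i2 p2 -> is_biprod i2 p2 i1 p1.
Proof. by case=> *; split; rewrite // addrC. Qed.

Lemma biprod_exists : is_additive C ->
  forall X Y, exists P (i1 : hom X P) p1 (i2 : hom Y P) p2,
    is_biprod i1 p1 i2 p2.
Proof.
move=> addC X Y; pose T (k : 'I_2) := if k == 0 then X else Y.
have [P [i [p [pi1 pi0 sum1]]]] := addC 2 T.
move: sum1 (pi1 0) (pi1 1) (pi0 0 1 isT) (pi0 1 0 isT).
rewrite big_ord_recl big_ord1 (_ : lift ord0 ord0 = 1); last exact: val_inj.
move: (i 0) (i 1) (p 0) (p 1); rewrite /T /= => i1 i2 p1 p2 *.
by exists P, i1, p1, i2, p2.
Qed.

Lemma zero_exists : is_additive C -> exists Z : C, is_zero Z.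
Proof.
move=> addC.
(* The empty direct sum is wanted; its family is vacuous, since an index [k] of ['I_0] would satisfy
   [k < 0]. *)
have [Z [i [p [_ _]]]] := addC 0 (fun k => False_rect C (notF (ltn_ord k))).
rewrite big_ord0 => id0.
by exists Z => Y; split=> f; [rewrite -[f]compm1 | rewrite -[f]comp1m];
  rewrite -id0 ?compm0 ?comp0m.
Qed.

(** Through [biprod_exact], this and its mirror image supply the short exact sequences [X -> X -> 0]
    and [0 -> X -> X]. *)
Lemma biprod_zero X Z : is_zero Z ->
  is_biprod (idm X) (idm X) (0 : hom Z X) (0 : hom X Z).
Proof.
move=> Z0; split; rewrite ?comp1m ?compm0 ?comp0m ?addr0 //.
by rewrite [idm Z](Z0 _).1.
Qed.

Section Biprod.
Variables (X Y P : C) (i1 : hom X P) (p1 : hom P X) (i2 : hom Y P)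
  (p2 : hom P Y).
Hypothesis bP : is_biprod i1 p1 i2 p2.

Lemma biprod_ext_in W (u v : hom W P) :
  p1 \oc u = p1 \oc v -> p2 \oc u = p2 \oc v -> u = v.
Proof.
move=> e1 e2; rewrite -[u]comp1m -[v]comp1m -(biprod_sum bP) !compDl -!compA.
by rewrite e1 e2.
Qed.

Lemma biprod_ext_out W (u v : hom P W) :
  u \oc i1 = v \oc i1 -> u \oc i2 = v \oc i2 -> u = v.
Proof.
move=> e1 e2; rewrite -[u]compm1 -[v]compm1 -(biprod_sum bP) !compDr !compA.
by rewrite e1 e2.
Qed.

Lemma biprod_pair1 W (a : hom W X) (b : hom W Y) :
  p1 \oc (i1 \oc a + i2 \oc b) = a.
Proof.
by rewrite compDr !compA (biprod11 bP) (biprod21 bP) comp1m comp0m addr0.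
Qed.

Lemma biprod_pair2 W (a : hom W X) (b : hom W Y) :
  p2 \oc (i1 \oc a + i2 \oc b) = b.
Proof.
by rewrite compDr !compA (biprod12 bP) (biprod22 bP) comp1m comp0m add0r.
Qed.

Lemma biprod_copair1 W (a : hom X W) (b : hom Y W) :
  (a \oc p1 + b \oc p2) \oc i1 = a.
Proof.
by rewrite compDl -!compA (biprod11 bP) (biprod12 bP) compm1 compm0 addr0.
Qed.

Lemma biprod_copair2 W (a : hom X W) (b : hom Y W) :
  (a \oc p1 + b \oc p2) \oc i2 = b.
Proof.
by rewrite compDl -!compA (biprod21 bP) (biprod22 bP) compm1 compm0 add0r.
Qed.

Lemma biprod_copair_pair V W (a : hom V X) (b : hom V Y) (c : hom X W)
    (d : hom Y W) :
  (c \oc p1 + d \oc p2) \oc (i1 \oc a + i2 \oc b) = c \oc a + d \oc b.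
Proof. by rewrite compDl -!compA biprod_pair1 biprod_pair2. Qed.

Lemma biprod_cokernel : is_cokernel p2 i1.
Proof.
apply: cokernelI => [|W u v e|W h h0]; first exact: biprod12 bP.
  by rewrite -[u]compm1 -[v]compm1 -(biprod22 bP) !compA e.
exists (h \oc i2); rewrite -[RHS]compm1 -(biprod_sum bP) compDr !compA h0.
by rewrite comp0m add0r.
Qed.

End Biprod.

(** Fullness determines the morphism predicate from the objects. As the equality is one of records,
    it uses functional and propositional extensionality for the predicates and proof irrelevance for
    the remaining fields. *)
Lemma full_subcat_id (D : subcat C) : is_full D -> full_subcat D = D.
Proof.
case: D => P H d c i m /= fullD.
have eH : (fun X Y (_ : hom X Y) => P X /\ P Y) = H.
  apply: functional_extensionality_dep => X.
  apply: functional_extensionality_dep => Y.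
  apply/funext => f; apply/propext; split=> [[PX PY] | Hf].
    exact: (fullD X Y f PX PY).
  by split; [exact: d Hf | exact: c Hf].
rewrite /full_subcat; move: d c i m {fullD}; rewrite -eH => d c i m.
by congr Subcat; apply: Prop_irrelevance.
Qed.

End Preadditive.

(** * Admissible monomorphisms and epimorphisms in an exact category *)

Section Exact.
Variables (E : preadditive) (S : seq_class E).
Hypothesis hE : is_exact S.
Implicit Types X Y Z W A K P M : E.

Lemma exact_kernel X Y Z (f : hom X Y) (g : hom Y Z) :
  S f g -> is_kernel f g.
Proof. by case/(exact_kercoker hE). Qed.

Lemma exact_cokernel X Y Z (f : hom X Y) (g : hom Y Z) :
  S f g -> is_cokernel g f.
Proof. by case/(exact_kercoker hE). Qed.

(** Two kernels of [g] differ by an isomorphism, and [S] is closed under isomorphism of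
    sequences. *)
Lemma adm_epi_kernel X Y Z (f : hom X Y) (g : hom Y Z) :
  adm_epi S g -> is_kernel f g -> S f g.
Proof.
move=> [K [k Skg]] kf; have kk := exact_kernel Skg.
have [u eu] := kernel_lift kf kk.1; have [v ev] := kernel_lift kk kf.1.
apply: (exact_iso_closed hE) Skg; exists u, (idm Y), (idm Z).
split; [by split; rewrite ?comp1m ?compm1 | | exact: idm_iso | exact: idm_iso].
by exists v; split; [apply: (kernel_inj kk) | apply: (kernel_inj kf)];
  rewrite compA ?ev ?eu ?ev ?compm1.
Qed.

Lemma adm_mono_cokernel X Y Z (f : hom X Y) (g : hom Y Z) :
  adm_mono S f -> is_cokernel g f -> S f g.
Proof.
move=> [K [k Sfk]] cg; have ck := exact_cokernel Sfk.
have [u eu] := cokernel_desc ck cg.1; have [v ev] := cokernel_desc cg ck.1.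
apply: (exact_iso_closed hE) Sfk; exists (idm X), (idm Y), u.
split; [by split; rewrite ?comp1m ?compm1 | exact: idm_iso | exact: idm_iso |].
by exists v; split; [apply: (cokernel_inj ck) | apply: (cokernel_inj cg)];
  rewrite -compA ?ev ?eu ?ev ?comp1m.
Qed.

(** The identity of [X] is the pullback of the identity of a zero object along [X -> 0]. *)
Lemma idm_adm_epi X : adm_epi S (idm X).
Proof.
have [Z Z0] := zero_exists (exact_additive hE).
have [_ pb] := exact_pullback hE (0 : hom X Z) (exact_id0 hE Z0).
apply: (pb X (idm X) 0); split=> [|W a b _]; first by rewrite compm0 comp0m.
exists a; split=> [|v []]; last by rewrite comp1m.
by rewrite comp1m comp0m [b](Z0 _).2.
Qed.

(** The kernel [k : K -> Y] of [idm Y] is an admissible monomorphism and is zero, so its pushout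
    along [0 : K -> X] is the biproduct; hence [i1] is admissible. *)
Lemma biprod_exact X Y P (i1 : hom X P) p1 (i2 : hom Y P) p2 :
  is_biprod i1 p1 i2 p2 -> S i1 p2.
Proof.
move=> bP; apply: adm_mono_cokernel; last exact: biprod_cokernel bP.
have [K [k Sk]] := idm_adm_epi Y.
have k0 : k = 0 by rewrite -[k]comp1m (exact_kernel Sk).1.
have [|_ po] := exact_pushout hE (f := k) (0 : hom K X).
  by exists Y, (idm Y).
apply: (po P i1 i2); split=> [|W a b _]; first by rewrite k0 !compm0.
exists (a \oc p1 + b \oc p2); split=> [|v [<- <-]].
  by rewrite (biprod_copair1 bP) (biprod_copair2 bP).
apply: (biprod_ext_out bP).
  by rewrite (biprod_copair1 bP).
by rewrite (biprod_copair2 bP).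
Qed.

(** The pair [(f, a)] is a kernel of the map [q : P -> Q] onto the pushout [Q] of [a] along [- f].
    Once [q] is known to be an admissible epimorphism, its kernel is an admissible monomorphism. *)
Lemma adm_mono_pair X Y M P (a : hom X M) (f : hom X Y)
    (i1 : hom Y P) p1 (i2 : hom M P) p2 :
  is_biprod i1 p1 i2 p2 -> adm_mono S a ->
  adm_mono S (i1 \oc f + i2 \oc a).
Proof.
move=> bP Sa; have [Z [c Sac]] := Sa.
(* The sign turns commutativity of the square into [a' \oc f + f' \oc a = 0], that is, [q] kills the
   pair. *)
have [[Q [a' [f' po]]] mono_po] := exact_pushout hE (- f) Sa.
have [Z' [d Sd]] := mono_po _ _ _ po.
have [sq po_ex] := po.
have [c' [[c'a' c'f'] _]] :
    exists! c' : hom Q Z, c' \oc a' = 0 /\ c' \oc f' = c.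
  by apply: po_ex; rewrite comp0m (exact_kernel Sac).1.
(* The map [a'] is a kernel of [c']: it is a kernel of its cokernel [d], and [d] factors through
   [c']. *)
have a'_lift W (h : hom W Q) : c' \oc h = 0 -> exists y, a' \oc y = h.
  move=> h0; have [|t et] := cokernel_desc (exact_cokernel Sac) (h := d \oc f').
    by rewrite -compA sq compA (exact_kernel Sd).1 comp0m.
  apply: (kernel_lift (exact_kernel Sd)).
  suff -> : d = t \oc c' by rewrite -compA h0 compm0.
  apply: (pushout_inj po); rewrite -compA.
    by rewrite c'a' compm0 (exact_kernel Sd).1.
  by rewrite c'f' et.
pose q := a' \oc p1 + f' \oc p2.
have qE W (h : hom W P) : q \oc h = a' \oc (p1 \oc h) + f' \oc (p2 \oc h).
  by rewrite compDl !compA.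
(* [P] is the pullback of [c] along [c'], so [q] inherits admissibility from
   [c]. *)
have epi_q : adm_epi S q.
  have [|_ epi_pb] := exact_pullback hE (g := c) c'; first by exists X, a.
  apply: (epi_pb P q p2); split=> [|W u m e].
    by rewrite compDr !compA c'a' c'f' comp0m add0r.
  (* The second coordinate of the map into [P] must be [m]; the first is what [u - f' \oc m] leaves
     to lift through [a']. *)
  have [|y ey] := a'_lift W (u - f' \oc m).
    by rewrite compBr compA c'f' e subrr.
  exists (i1 \oc y + i2 \oc m).
  split=> [|v [ev1 ev2]].
    by rewrite qE (biprod_pair1 bP) (biprod_pair2 bP) ey subrK.
  apply: (biprod_ext_in bP); last by rewrite (biprod_pair2 bP).
  rewrite (biprod_pair1 bP); apply: (kernel_inj (exact_kernel Sd)).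
  by rewrite ey -ev1 qE ev2 addrK.
exists Q, q; apply: adm_epi_kernel => //.
have e1 := biprod_pair1 bP f a; have e2 := biprod_pair2 bP f a.
apply: kernelI => [|W u v e|W h h0].
- by rewrite qE e1 e2 sq compmN subrr.
- by apply: (kernel_inj (exact_kernel Sac)); rewrite -e2 -!compA e.
(* Applying [c'] to [q \oc h = 0] leaves [c \oc (p2 \oc h) = 0], so the second coordinate of [h]
   factors through [a]. *)
have [|x ex] := kernel_lift (exact_kernel Sac) (h := p2 \oc h).
  have := congr1 (comp c') h0; rewrite qE compDr !compA c'a' c'f'.
  by rewrite !comp0m add0r compm0.
exists x; apply: (biprod_ext_in bP); rewrite compA ?e1 ?e2 //.
(* The first coordinates are compared after composing with the monomorphism [a'], where
   [q \oc h = 0] and the pushout square apply. *)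
apply: (kernel_inj (exact_kernel Sd)).
move: h0; rewrite qE -ex (compA f') sq => /eqP; rewrite addr_eq0 => /eqP ->.
by rewrite compmN compNm opprK compA.
Qed.

(** Dual to [adm_mono_pair]: the copair is a cokernel of the map [q : Q -> P] from the pullback [Q]
    of [b] along [- g]. *)
Lemma adm_epi_copair X Y M P (b : hom M X) (g : hom Y X)
    (i1 : hom Y P) p1 (i2 : hom M P) p2 :
  is_biprod i1 p1 i2 p2 -> adm_epi S b ->
  adm_epi S (g \oc p1 + b \oc p2).
Proof.
move=> bP Sb; have [K [k Skb]] := Sb.
have [[Q [b' [g' pb]]] epi_pb] := exact_pullback hE (- g) Sb.
have [K' [d Sd]] := epi_pb _ _ _ pb.
have [sq pb_ex] := pb.
have [k' [[b'k' g'k'] _]] :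
    exists! k' : hom K Q, b' \oc k' = 0 /\ g' \oc k' = k.
  by apply: pb_ex; rewrite compm0 (exact_kernel Skb).1.
(* The map [b'] is a cokernel of [k'], because its kernel [d] factors through [k']. *)
have b'_desc W (h : hom Q W) : h \oc k' = 0 -> exists y, y \oc b' = h.
  move=> h0; have [|t et] := kernel_lift (exact_kernel Skb) (h := g' \oc d).
    by rewrite compA sq -compA (exact_kernel Sd).1 compm0.
  apply: (cokernel_desc (exact_cokernel Sd)).
  suff -> : d = k' \oc t by rewrite compA h0 comp0m.
  apply: (pullback_inj pb); rewrite compA.
    by rewrite b'k' comp0m (exact_kernel Sd).1.
  by rewrite g'k' et.
pose q := i1 \oc b' + i2 \oc g'.
have qE W (h : hom P W) : h \oc q = (h \oc i1) \oc b' + (h \oc i2) \oc g'.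
  by rewrite compDr !compA.
(* [P] is the pushout of [k] along [k'], and [q] is the map opposite to [k]. *)
have mono_q : adm_mono S q.
  have [|_ mono_po] := exact_pushout hE (f := k) k'; first by exists X, b.
  apply: (mono_po P q i2); split=> [|W u m e].
    by rewrite compDl -!compA b'k' g'k' compm0 add0r.
  have [|y ey] := b'_desc W (u - m \oc g').
    by rewrite compBl -compA g'k' e subrr.
  exists (y \oc p1 + m \oc p2).
  split=> [|v [ev1 ev2]].
    by rewrite qE (biprod_copair1 bP) (biprod_copair2 bP) ey subrK.
  apply: (biprod_ext_out bP); last by rewrite (biprod_copair2 bP).
  rewrite (biprod_copair1 bP); apply: (cokernel_inj (exact_cokernel Sd)).
  by rewrite ey -ev1 qE ev2 addrK.
exists Q, q; apply: adm_mono_cokernel => //.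
have e1 := biprod_copair1 bP g b; have e2 := biprod_copair2 bP g b.
apply: cokernelI => [|W u v e|W h h0].
- by rewrite qE e1 e2 sq compNm subrr.
- by apply: (cokernel_inj (exact_cokernel Skb)); rewrite -e2 !compA e.
have [|x ex] := cokernel_desc (exact_cokernel Skb) (h := h \oc i2).
  have := congr1 (fun u => u \oc k') h0; rewrite qE compDl -!compA b'k' g'k'.
  by rewrite !compm0 add0r comp0m.
exists x; apply: (biprod_ext_out bP); rewrite -compA ?e1 ?e2 //.
apply: (cokernel_inj (exact_cokernel Sd)).
move: h0; rewrite qE -ex -(compA x) sq => /eqP; rewrite addr_eq0 => /eqP ->.
by rewrite compNm compmN opprK compA.
Qed.

(** * Biproducts in complete subcategories *)

Section Subcategory.
Variable D : subcat E.
Hypothesis compD : is_complete S D.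

Lemma complete_biprod X Y P (i1 : hom X P) p1 (i2 : hom Y P) p2 :
  is_biprod i1 p1 i2 p2 -> D X -> D Y -> D P.
Proof. by case: compD => _ _ h /biprod_exact/h[_]. Qed.

Lemma complete_biprodl X Y P (i1 : hom X P) p1 (i2 : hom Y P) p2 :
  is_biprod i1 p1 i2 p2 -> D P -> D Y -> D X.
Proof. by case: compD => _ _ h /biprod_exact/h[_]. Qed.

End Subcategory.

(** * Transfer of objects, sequences and subcategories between [E] and [E/N] *)

Section Quotient.
Variables (N : subcat E) (hN : dsum_closed N).
Local Notation EN := (quotient_cat hN).

Lemma qmor_comp X Y Z (g : hom Y Z) (f : hom X Y) :
  qmor hN g \oc qmor hN f = qmor hN (g \oc f).
Proof. exact: qcompE. Qed.

Lemma qmor_surj X Y (u : @hom EN X Y) : exists f : hom X Y, u = qmor hN f.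
Proof. by exists (repr u); rewrite /qmor qclass_repr. Qed.

Lemma qmor_eq X Y (f g : hom X Y) :
  qmor hN f = qmor hN g <-> factors_through N (f - g).
Proof. exact: qclassP. Qed.

Lemma qmor0 X Y : qmor hN (0 : hom X Y) = 0.
Proof. exact: raddf0. Qed.

Lemma qmor_zero X : N X -> @is_zero EN X.
Proof.
move=> NX Y; split=> u; have [f ->] := qmor_surj u; rewrite -qmor0;
  apply/qmor_eq; rewrite subr0.
  by exists X, (idm X), f; rewrite compm1.
by exists X, f, (idm X); rewrite comp1m.
Qed.

Lemma zero_qmor_zero X : is_zero X -> @is_zero EN X.
Proof.
move=> X0 Y; split=> u; have [f ->] := qmor_surj u; rewrite -qmor0.
  by rewrite [f](X0 Y).1.
by rewrite [f](X0 Y).2.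
Qed.

(** The identity of [X] is zero modulo [N], so it factors through an object of [N], of which [X] is
    then a summand. *)
Lemma quotient_zero_mem X :
  summand_closed N -> @is_zero EN X -> N X.
Proof.
move=> sumN X0; have : @idm EN X = qmor hN 0 by rewrite [LHS](X0 X).1 qmor0.
move/qmor_eq; rewrite subr0 => -[M [a [b [NM e]]]].
by apply: sumN NM; exists a, b.
Qed.

Lemma iso_quotient_zero X Y (f : @hom EN X Y) :
  is_iso f -> is_zero Y -> @is_zero EN X.
Proof.
move=> [g [gf _]] /zero_qmor_zero Y0.
have id0 : @idm EN X = 0 by rewrite -gf [f](Y0 _).2 compm0.
by move=> W; split=> h; [rewrite -[h]compm1 | rewrite -[h]comp1m];
  rewrite id0 ?compm0 ?comp0m.
Qed.

Lemma qmor_exact X Y Z (f : hom X Y) (g : hom Y Z) :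
  S f g -> quotient_seqs hN S X Y Z (qmor hN f) (qmor hN g).
Proof.
move=> Sfg; exists X, Y, Z, f, g; split=> //.
exists (@idm EN X), (@idm EN Y), (@idm EN Z).
by split; [split; rewrite comp1m compm1 | exact: idm_iso ..].
Qed.

(** A sequence of the quotient is termwise isomorphic to the image of one in [S]. Closure under
    isomorphism in [E/N] carries membership there, two-out-of-three is applied in [E], and the
    result is carried back. *)
Lemma F_complete (D : subcat E) :
  is_complete S D ->
  (forall X Y (u : @hom EN X Y), is_iso u -> D X -> D Y) ->
  is_complete (quotient_seqs hN S) (F_sub hN D).
Proof.
move=> [[X0 DX0] fullD two3] isoD.
have isoD' X Y (u : @hom EN X Y) : is_iso u -> D Y -> D X.
  by case=> v [vu uv]; apply: (isoD _ _ v); exists u.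
split; [by exists X0 | by [] |].
move=> X Y Z u v [X' [Y' [Z' [f [g [Sfg [a [b [c [_ ia ib ic]]]]]]]]]].
have [DZ DY DX] := two3 _ _ _ _ _ Sfg.
split=> /= [hX hY|hX hZ|hY hZ].
- by apply: (isoD' _ _ c ic); apply: DZ; [exact: isoD ia _ | exact: isoD ib _].
- by apply: (isoD' _ _ b ib); apply: DY; [exact: isoD ia _ | exact: isoD ic _].
- by apply: (isoD' _ _ a ia); apply: DX; [exact: isoD ib _ | exact: isoD ic _].
Qed.

Lemma G_complete (D : subcat EN) :
  is_complete (quotient_seqs hN S) D -> is_complete S (G_sub hN D).
Proof.
move=> [D0 fullD two3]; split=> // X Y Z f g Sfg.
exact: two3 (qmor_exact Sfg).
Qed.

Lemma G_contains (D : subcat EN) :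
  is_complete (quotient_seqs hN S) D -> contains (G_sub hN D) N.
Proof.
move=> [[X DX] _ two3] M NM; have [Z Z0] := zero_exists (exact_additive hE).
have M0 := qmor_zero NM; have qZ0 := zero_qmor_zero Z0.
have Sx : quotient_seqs hN S X X M (@idm EN X) (0 : @hom EN X M).
  (* The sequence lifted to [E] ends in a zero object [Z] of [E] instead of [M]; the two become
     isomorphic in [E/N]. *)
  exists X, X, Z, (@idm E X), 0.
  split; first exact: biprod_exact (biprod_zero (X : E) Z0).
  exists (@idm EN X), (@idm EN X), 0; split; try exact: idm_iso.
  - by split; rewrite // comp0m compm1 [qmor _ _](qZ0 _).2.
  - exact: zero_iso.
by have [h _ _] := two3 _ _ _ _ _ Sx; exact: h.
Qed.

(** Stated for summands in [E/N], this gives both thickness of the image of [D] and its closure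
    under isomorphism. *)
Lemma thick_quotient_summand (D : subcat E) :
  is_thick S D -> contains D N ->
  forall A X, @is_summand EN A X -> D X -> D A.
Proof.
move=> [compD sumD] DN A X [u [v vu]] DX.
have [i ei] := qmor_surj u; have [p ep] := qmor_surj v.
move: vu; rewrite ei ep qmor_comp => /qmor_eq[M [a [b [NM eab]]]].
have [P [i1 [p1 [i2 [p2 bP]]]]] := biprod_exists (exact_additive hE) X M.
apply: (sumD A P); last exact: (complete_biprod compD bP DX (DN _ NM)).
(* Since [p \oc i - idm A = b \oc a], the extra coordinate through [M] corrects [p \oc i] to the
   identity, now in [E] itself. *)
exists (i1 \oc i + i2 \oc a), (p \oc p1 + (- b) \oc p2).
by rewrite (biprod_copair_pair bP) compNm -eab opprB addrCA subrr addr0.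
Qed.

Lemma complete_quotient_iso (D : subcat E) :
  factorization_admissible S N -> weak_five_lemma (quotient_seqs hN S) ->
  is_complete S D -> contains D N ->
  forall X Y (u : @hom EN X Y), is_iso u -> D X -> D Y.
Proof.
move=> [_ sumN factN] wfl compD DN X Y u [v [vu uv]] DX.
have [f ef] := qmor_surj u; have [g eg] := qmor_surj v; subst u v.
move: (vu); rewrite qmor_comp => /qmor_eq/factN[M [a [b [NM eab adm]]]].
have [P [i1 [p1 [i2 [p2 bP]]]]] := biprod_exists (exact_additive hE) Y M.
have [Z Z0] := zero_exists (exact_additive hE).
have qZ0 := zero_qmor_zero Z0; have bZ := biprod_zero X Z0.
suff DP : D P by exact: (complete_biprodl compD bP DP (DN _ NM)).
have [_ _ two3] := compD.
(* Adding the summand [M] changes nothing modulo [N]: the defect [i2 \oc p2] factors through [M]. *)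
have ip : qmor hN i1 \oc qmor hN p1 = @idm EN P.
  rewrite qmor_comp; apply/qmor_eq; rewrite -(biprod_sum bP) opprD addNKr.
  by exists M, p2, (- i2); rewrite compNm.
have pi : qmor hN p1 \oc qmor hN i1 = @idm EN Y.
  by rewrite qmor_comp (biprod11 bP).
have if_ : is_iso (qmor hN f) by exists (qmor hN g).
have ig : is_iso (qmor hN g) by exists (qmor hN f).
have ii1 : is_iso (qmor hN i1) by exists (qmor hN p1).
have ip1 : is_iso (qmor hN p1) by exists (qmor hN i1).
case: adm => [Sa | Sb].
  have [K [k Sk]] := adm_mono_pair f bP Sa.
  have [_ DP _] := two3 _ _ _ _ _ Sk; apply: DP => //; apply: DN.
  (* Comparison of [X -> P -> K] with [X -> X -> 0]; the middle map is [g] after [p1], an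
     isomorphism in [E/N], and the left square is [g \oc f = 1]. *)
  have m : @seq_mor EN _ _ _ _ _ _ (qmor hN (i1 \oc f + i2 \oc a)) (qmor hN k)
      (qmor hN (idm X)) (qmor hN (0 : hom X Z))
      (@idm EN X) (qmor hN g \oc qmor hN p1) 0.
    split; last by rewrite [LHS](qZ0 _).2 [RHS](qZ0 _).2.
    by rewrite compm1 -compA qmor_comp (biprod_pair1 bP) vu.
  have [iK _] := wfl _ _ _ _ _ _ _ _ _ _ _ _ _
    (qmor_exact Sk) (qmor_exact (biprod_exact bZ)) m.
  apply: (quotient_zero_mem sumN); apply: iso_quotient_zero Z0.
  exact: iK (@idm_iso EN X) (iso_comp ig ip1) qZ0.
have [K [k Sk]] := adm_epi_copair g bP Sb.
have [_ DP _] := two3 _ _ _ _ _ Sk; apply: DP => //; apply: DN.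
(* Dually, [0 -> X -> X] is mapped to [K -> P -> X], with middle map [i1] after [f]. *)
have m : @seq_mor EN _ _ _ _ _ _ (qmor hN (0 : hom Z X)) (qmor hN (idm X))
    (qmor hN k) (qmor hN (g \oc p1 + b \oc p2))
    0 (qmor hN i1 \oc qmor hN f) (@idm EN X).
  split; first by rewrite [LHS](qZ0 _).1 [RHS](qZ0 _).1.
  by rewrite comp1m compA qmor_comp (biprod_copair1 bP) vu.
have [_ iK] := wfl _ _ _ _ _ _ _ _ _ _ _ _ _
  (qmor_exact (biprod_exact (biprodC bZ))) (qmor_exact Sk) m.
have [j [j0 oj]] := iK (iso_comp ii1 if_) (@idm_iso EN X) qZ0.
apply: (quotient_zero_mem sumN).
by apply: (@iso_quotient_zero _ _ j _ Z0); exists 0.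
Qed.

End Quotient.
End Exact.

Theorem theorem3p13 (E : preadditive) (S : seq_class E) (hE : is_exact S)
    (N : subcat E) (hfull : is_full N) (hN : dsum_closed N) :
  mutually_inverse
    (fun D : subcat E => is_thick S D /\ contains D N)
    (fun D : subcat (quotient_cat hN) => is_thick (quotient_seqs hN S) D)
    (F_sub hN) (G_sub hN)
  /\
  (factorization_admissible S N ->
   weak_five_lemma (quotient_seqs hN S) ->
   mutually_inverse
     (fun D : subcat E => is_complete S D /\ contains D N)
     (fun D : subcat (quotient_cat hN) => is_complete (quotient_seqs hN S) D)
     (F_sub hN) (G_sub hN)).
Proof.
split=> [|factN wfl]; split.
- move=> D [thickD DN]; have sumD := thick_quotient_summand hE thickD DN.
  split; last exact: sumD.
  (* One half of the isomorphism, [u \oc v = 1], already exhibits [Y] as a summand of [X] in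
     [E/N]. *)
  apply: (F_complete thickD.1) => X Y u [v [_ uv]].
  by apply: sumD; exists v, u.
- move=> D [compD sumD]; split; last exact: (G_contains hE compD).
  split; first exact: G_complete compD.
  move=> A X [i [p pi]]; apply: sumD; exists (qmor hN i), (qmor hN p).
  by rewrite qmor_comp pi.
(* Both round trips unfold to [full_subcat] on the objects of [D], so only fullness remains to be
   used. *)
- by move=> D [[[_ fullD _] _] _]; exact: full_subcat_id.
- by move=> D [[_ fullD _] _]; exact: full_subcat_id.
- move=> D [compD DN]; apply: (F_complete compD).
  exact: (complete_quotient_iso hE factN wfl compD DN).
- move=> D compD; split; first exact: G_complete compD.
  exact: (G_contains hE compD).
- by move=> D [[_ fullD _] _]; exact: full_subcat_id.
- by move=> D [_ fullD _]; exact: full_subcat_id.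
Qed.
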